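(* For every positive integer $k$, the class $\mathcal{CW}_k$ of finite matroids of cyclic width at most $k$ is closed under duals, minors, and free products.
   Context: A flat of a matroid is cyclic if it is a (possibly empty) union of circuits; $\mathcal{Z}(M)$ is the lattice of cyclic flats of $M$ ordered by inclusion. The cyclic width of $M$ is the width of $\mathcal{Z}(M)$, i.e. the maximum size of an antichain (set of pairwise incomparable elements) in it. The free product $M\Box N$ of matroids on disjoint ground sets is the matroid on $E(M)\cup E(N)$ whose cyclic flats are exactly the sets in $\mathcal{Z}$ with ranks given by $r$, where $\mathcal{Z}'=\{X: X\in\mathcal{Z}(M), X\ne E(M)\}\cup\{E(M)\cup Y: Y\in\mathcal{Z}(N), Y\ne\emptyset\}$; $\mathcal{Z}=\mathcal{Z}'\cup\{E(M)\}$ if $M$ has no isthmuses and $N$ has no loops, and $\mathcal{Z}=\mathcal{Z}'$ otherwise; $r(X)=r_M(X)$ for $X\subseteq E(M)$ and $r(E(M)\cup Y)=r(M)+r_N(Y)$. *)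

(* Defs.v *)
From mathcomp Require Import all_boot.
From mathcomp Require Import zify.

Set Implicit Arguments.
Unset Strict Implicit.
Unset Printing Implicit Defensive.

Section Matroids.

Context {T : finType}.
Implicit Types (E X Y C D : {set T}) (F : {set {set T}}).

Definition matroid_axioms E (I : {set {set T}}) : bool :=
  [&& I \subset powerset E,
      set0 \in I,
      [forall X in I, powerset X \subset I] &
      [forall X in I, forall Y in I,
         (#|X| < #|Y|) ==> [exists y in Y :\: X, y |: X \in I]]].

(* The ground set is a subset of T rather than T itself, so that minors of a
   matroid live on the same type T, and two matroids on T may have disjoint
   ground sets. *)
Record matroid := Matroid {
  ground : {set T};
  indep : {set {set T}};
  matroidP : matroid_axioms ground indep }.

Implicit Types M N P : matroid.

Definition rank M X : nat := \max_(I in indep M | I \subset X) #|I|.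

Definition bases M : {set {set T}} :=
  [set B | maxset (fun X => X \in indep M) B].

Definition circuits M : {set {set T}} :=
  [set C | minset (fun X => (X \subset ground M) && (X \notin indep M)) C].

Definition loop M e : bool := [set e] \in circuits M.

Definition isthmus M e : bool :=
  (e \in ground M) && [forall B in bases M, e \in B].

Definition flat M X : bool :=
  (X \subset ground M) &&
  [forall y in ground M :\: X, rank M X < rank M (y |: X)].

Definition cyclic_flats M : {set {set T}} :=
  [set X | flat M X &&
     [exists S : {set {set T}}, (S \subset circuits M) && (X == cover S)]].

Definition antichain F : bool :=
  [forall X in F, forall Y in F, (X \subset Y) ==> (X == Y)].

Definition width F : nat := \max_(A in powerset F | antichain A) #|A|.

Definition cyclic_width M : nat := width (cyclic_flats M).

Definition CW k M : bool := cyclic_width M <= k.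

Definition Zprime M N : {set {set T}} :=
  [set X in cyclic_flats M | X != ground M] :|:
  [set ground M :|: Y | Y in cyclic_flats N & Y != set0].

(* ground M is a cyclic flat of the free product exactly when M has no isthmus
   and N has no loop. *)
Definition Zfree M N : {set {set T}} :=
  if [forall e, ~~ isthmus M e] && [forall e, ~~ loop N e]
  then ground M |: Zprime M N else Zprime M N.

(* On the overlap of the two rank clauses, i.e. at the set ground M, both
   prescribe rank M (ground M). *)
Definition is_free_product M N P : Prop :=
  [/\ [disjoint ground M & ground N],
      ground P = ground M :|: ground N,
      cyclic_flats P = Zfree M N,
      (forall X, X \in Zfree M N -> X \subset ground M ->
         rank P X = rank M X) &
      (forall Y, Y \subset ground N -> ground M :|: Y \in Zfree M N ->
         rank P (ground M :|: Y) = rank M (ground M) + rank N Y)].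

Lemma indep_sub M X : X \in indep M -> X \subset ground M.
Proof.
by case/and4P: (matroidP M) => /subsetP s _ _ _ /s; rewrite powersetE.
Qed.

Lemma indep0 M : set0 \in indep M.
Proof. by case/and4P: (matroidP M). Qed.

Lemma indepS M X Y : X \subset Y -> Y \in indep M -> X \in indep M.
Proof.
case/and4P: (matroidP M) => _ _ /forall_inP h _ sXY /h /subsetP; apply.
by rewrite powersetE.
Qed.

Lemma indep_aug M X Y : X \in indep M -> Y \in indep M -> #|X| < #|Y| ->
  exists2 y, y \in Y :\: X & y |: X \in indep M.
Proof.
case/and4P: (matroidP M) => _ _ _ /forall_inP h iX iY lt.
by have /exists_inP := implyP (forall_inP (h X iX) Y iY) lt.
Qed.

Lemma rank_ge M I X : I \in indep M -> I \subset X -> #|I| <= rank M X.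
Proof.
move=> iI sI; rewrite /rank.
by apply: (leq_bigmax_cond (F := fun I : {set T} => #|I|)); rewrite iI.
Qed.

Lemma indep_extend M I X : I \in indep M -> I \subset X ->
  exists J, [/\ J \in indep M, I \subset J, J \subset X & #|J| = rank M X].
Proof.
move=> iI sI.
pose Q J := [&& J \in indep M, I \subset J & J \subset X].
have QI : Q I by rewrite /Q iI sI subxx.
case: (arg_maxnP (fun J : {set T} => #|J|) QI) => J /and3P[iJ sIJ sJX] mJ.
exists J; split=> //; apply/eqP; rewrite eqn_leq rank_ge //=.
apply/bigmax_leqP => K /andP[iK sKX]; rewrite leqNgt; apply/negP => lt.
have [y /setDP[yK yJ] iyJ] := indep_aug iJ iK lt.
have /mJ : Q (y |: J).
  rewrite /Q iyJ (subset_trans sIJ (subsetUr _ _)) subUset sJX sub1set.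
  by rewrite (subsetP sKX _ yK).
by rewrite cardsU1 yJ; lia.
Qed.

Lemma rank_card M X : rank M X <= #|X|.
Proof. by apply/bigmax_leqP => I /andP[_ /subset_leq_card]. Qed.

Lemma rankS M X Y : X \subset Y -> rank M X <= rank M Y.
Proof.
move=> s; apply/bigmax_leqP => I /andP[iI sI].
by apply: rank_ge => //; apply: subset_trans s.
Qed.

Lemma indepE M X : (X \in indep M) = (rank M X == #|X|).
Proof.
apply/idP/eqP => [iX | rX].
  by apply/eqP; rewrite eqn_leq rank_card rank_ge.
have [J [iJ _ sJ cJ]] := indep_extend (indep0 M) (sub0set X).
suff <- : J = X by [].
by apply/eqP; rewrite eqEcard sJ cJ rX leqnn.
Qed.

Lemma rank_submod M X Y :
  rank M (X :|: Y) + rank M (X :&: Y) <= rank M X + rank M Y.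
Proof.
have [I [iI _ sI cI]] := indep_extend (indep0 M) (sub0set (X :&: Y)).
have sIU : I \subset X :|: Y.
  by apply: subset_trans sI _; apply: subset_trans (subsetIl _ _) (subsetUl _ _).
have [J [iJ sIJ sJ cJ]] := indep_extend iI sIU.
have h1 := rank_ge (indepS (subsetIl J X) iJ) (subsetIr J X).
have h2 := rank_ge (indepS (subsetIl J Y) iJ) (subsetIr J Y).
have := cardsUI (J :&: X) (J :&: Y).
rewrite -setIUr (setIidPl sJ).
have : #|I| <= #|(J :&: X) :&: (J :&: Y)|.
  apply: subset_leq_card; rewrite !subsetI sIJ.
  by move: sI; rewrite subsetI => /andP[-> ->].
lia.
Qed.

Lemma rankI M X : rank M (X :&: ground M) = rank M X.
Proof.
apply/eqP; rewrite eqn_leq rankS ?subsetIl //=.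
apply/bigmax_leqP => I /andP[iI sI]; apply: rank_ge => //.
by rewrite subsetI sI indep_sub.
Qed.

Lemma setU_diff X Y : X :|: (Y :\: X) = X :|: Y.
Proof. by apply/setP => z; rewrite !inE; case: (z \in X). Qed.

Lemma rank_diff M X Y : rank M X <= rank M Y + #|X :\: Y|.
Proof.
have h := rank_submod M Y (X :\: Y); have h2 := rank_card M (X :\: Y).
suff : rank M X <= rank M (Y :|: (X :\: Y)) by lia.
by apply: rankS; rewrite setU_diff subsetUr.
Qed.

Lemma basesE M B : (B \in bases M) =
  (B \in indep M) && (#|B| == rank M (ground M)).
Proof.
rewrite inE; apply/maxsetP/andP => -[iB].
  move=> mB; split=> //.
  have [J [iJ sBJ _ <-]] := indep_extend iB (indep_sub iB).
  by rewrite (mB J iJ sBJ).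
move=> /eqP cB; split=> // J iJ sBJ; apply/esym/eqP; rewrite eqEcard sBJ cB.
by rewrite rank_ge // indep_sub.
Qed.

Section FromRank.

Variables (E : {set T}) (r : {set T} -> nat).
Hypothesis r_card : forall X, r X <= #|X|.
Hypothesis rS : forall X Y, X \subset Y -> r X <= r Y.
Hypothesis r_submod : forall X Y, r (X :|: Y) + r (X :&: Y) <= r X + r Y.

Definition rank_indep := [set X : {set T} | (X \subset E) && (r X == #|X|)].

Lemma r_closure X Y : (forall y, y \in Y -> r (y |: X) = r X) ->
  r (X :|: Y) = r X.
Proof.
move=> h; suff k (s : seq T) : {subset s <= Y} -> r (X :|: [set y in s]) = r X.
  by rewrite -[Y]set_enum; apply: k => y; rewrite mem_enum.
elim: s => [|a s IH] sY; first by rewrite set_nil setU0.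
have ha := h a (sY a (mem_head _ _)).
have {}IH : r (X :|: [set y in s]) = r X.
  by apply: IH => y ys; apply: sY; rewrite inE ys orbT.
have := r_submod (a |: X) (X :|: [set y in s]).
have -> : a |: X :|: (X :|: [set y in s]) = X :|: [set y in a :: s].
  by apply/setP => z; rewrite !inE; do !case: (_ \in _); rewrite ?orbT ?orbF.
have : r X <= r ((a |: X) :&: (X :|: [set y in s])).
  by apply: rS; rewrite subsetI subsetUr subsetUl.
have : r X <= r (X :|: [set y in a :: s]) by apply: rS; apply: subsetUl.
rewrite ha IH; lia.
Qed.

Lemma r_step X y : r (y |: X) <= (r X).+1.
Proof. by have := r_submod [set y] X; have := r_card [set y]; rewrite cards1; lia. Qed.

Lemma rank_indepP : matroid_axioms E rank_indep.
Proof.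
apply/and4P; split.
- by apply/subsetP => X; rewrite !inE => /andP[].
- by rewrite inE sub0set cards0 -leqn0 -(cards0 T) r_card.
- apply/forall_inP => X; rewrite inE => /andP[sX /eqP rX].
  apply/subsetP => Y; rewrite powersetE => sYX.
  rewrite inE (subset_trans sYX sX) eqn_leq r_card /=.
  have := r_submod Y (X :\: Y); have := r_card (X :\: Y).
  rewrite setU_diff (setUidPr sYX) rX cardsD (setIidPr sYX).
  have := subset_leq_card sYX; lia.
apply/forall_inP => X; rewrite inE => /andP[sX /eqP rX].
apply/forall_inP => Y; rewrite inE => /andP[sY /eqP rY].
apply/implyP => lt; apply: contraT; rewrite negb_exists_in => /forall_inP h.
suff e : r (X :|: Y) = r X by have := rS (subsetUr X Y); rewrite e; lia.
apply: r_closure => y yY; have [yX | yX] := boolP (y \in X).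
  by congr r; apply/setUidPr; rewrite sub1set.
have := h y; rewrite inE yX yY => /(_ isT).
rewrite inE subUset sub1set (subsetP sY _ yY) sX cardsU1 yX /=.
by have := r_step X y; have := rS (subsetUr [set y] X); lia.
Qed.

Definition rank_matroid := Matroid rank_indepP.

Lemma rank_matroidE X : X \subset E -> rank rank_matroid X = r X.
Proof.
move=> sXE; apply/eqP; rewrite eqn_leq; apply/andP; split.
  apply/bigmax_leqP => I /andP[]; rewrite inE => /andP[_ /eqP <-]; exact: rS.
have [J [iJ _ sJX cJ]] := indep_extend (indep0 rank_matroid) (sub0set X).
rewrite -cJ; move: (iJ); rewrite inE => /andP[sJE /eqP rJ].
rewrite -rJ -(r_closure (X := J) (Y := X)) ?(setUidPr sJX) // => y yX.
have [yJ | yJ] := boolP (y \in J); first by rewrite (setUidPr _) ?sub1set.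
apply/eqP; rewrite eqn_leq (rS (subsetUr _ _)) andbT leqNgt; apply/negP => lt.
have iyJ : y |: J \in indep rank_matroid.
  rewrite inE subUset sub1set (subsetP sXE _ yX) sJE cardsU1 yJ /=.
  by have := r_step J y; lia.
have := rank_ge (X := X) iyJ; rewrite subUset sub1set yX sJX cardsU1 yJ.
by move=> /(_ isT); lia.
Qed.

End FromRank.

Definition dual_indep M : {set {set T}} :=
  [set X : {set T} | (X \subset ground M) && [exists B in bases M, [disjoint X & B]]].

Definition dual_rank M X : nat :=
  #|X| + rank M (~: X) - rank M (ground M).

Lemma dual_rank_sub M X : rank M (ground M) <= #|X| + rank M (~: X).
Proof.
have := rank_diff M (ground M) (~: X); rewrite setDE setCK.
by have := subset_leq_card (subsetIr (ground M) X); lia.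
Qed.

Lemma dual_rank_card M X : dual_rank M X <= #|X|.
Proof.
rewrite /dual_rank; suff : rank M (~: X) <= rank M (ground M) by lia.
by rewrite -rankI rankS ?subsetIr.
Qed.

Lemma dual_rankS M X Y : X \subset Y -> dual_rank M X <= dual_rank M Y.
Proof.
move=> s; rewrite /dual_rank; have := rank_diff M (~: X) (~: Y).
rewrite setDE setCK setIC -setDE cardsD (setIidPr s).
have := subset_leq_card s; lia.
Qed.

Lemma dual_rank_submod M X Y :
  dual_rank M (X :|: Y) + dual_rank M (X :&: Y) <= dual_rank M X + dual_rank M Y.
Proof.
rewrite /dual_rank; have := rank_submod M (~: X) (~: Y).
rewrite -setCI -setCU; have := cardsUI X Y.
have := dual_rank_sub M X; have := dual_rank_sub M Y.
have := dual_rank_sub M (X :|: Y); have := dual_rank_sub M (X :&: Y); lia.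
Qed.

Lemma dual_indepE M : dual_indep M = rank_indep (ground M) (dual_rank M).
Proof.
apply/setP => X; rewrite !inE; congr andb.
have h : (dual_rank M X == #|X|) = (rank M (ground M) <= rank M (~: X)).
  rewrite eqn_leq dual_rank_card /= /dual_rank.
  by have := dual_rank_sub M X; lia.
rewrite h; apply/exists_inP/idP => [[B]|le].
  rewrite basesE => /andP[iB /eqP <-] dXB; apply: rank_ge => //.
  by rewrite -disjoints_subset disjoint_sym.
have [J [iJ _ sJ cJ]] := indep_extend (indep0 M) (sub0set (~: X)).
exists J; last by rewrite disjoint_sym disjoints_subset.
rewrite basesE iJ eqn_leq cJ le andbT -rankI; apply: rankS; exact: subsetIr.
Qed.

Lemma dual_indepP M : matroid_axioms (ground M) (dual_indep M).
Proof.
rewrite dual_indepE; apply: rank_indepP.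
- exact: dual_rank_card.
- exact: dual_rankS.
- exact: dual_rank_submod.
Qed.

Definition dual M : matroid := Matroid (dual_indepP M).

Definition delete_indep M D : {set {set T}} :=
  [set X in indep M | X \subset ground M :\: D].

Lemma delete_indepP M D : matroid_axioms (ground M :\: D) (delete_indep M D).
Proof.
apply/and4P; split.
- by apply/subsetP => X; rewrite !inE => /andP[].
- by rewrite inE indep0 sub0set.
- apply/forall_inP => X; rewrite inE => /andP[iX sX].
  apply/subsetP => Y; rewrite powersetE => sYX.
  by rewrite inE (indepS sYX iX) (subset_trans sYX sX).
apply/forall_inP => X; rewrite inE => /andP[iX sX].
apply/forall_inP => Y; rewrite inE => /andP[iY sY].
apply/implyP => lt; have [y yY iy] := indep_aug iX iY lt.
apply/exists_inP; exists y => //; rewrite inE iy subUset sX sub1set andbT.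
by apply: (subsetP sY); case/setDP: yY.
Qed.

Definition delete M D : matroid := Matroid (delete_indepP M D).

(* M/C = (M* \ C)*, the textbook definition of contraction through duality. *)
Definition contract M C : matroid := dual (delete (dual M) C).

Definition minor N M : Prop :=
  exists C D, [/\ C \subset ground M, D \subset ground M, [disjoint C & D]
                & N = delete (contract M C) D].

Lemma cyclicP M X : X \subset ground M ->
  reflect (forall x, x \in X -> rank M (X :\ x) = rank M X)
    [exists S : {set {set T}}, (S \subset circuits M) && (X == cover S)].
Proof.
move=> sX; apply: (iffP existsP) => [[S /andP[/subsetP sS /eqP eX]] x | h].
  rewrite {1}eX => /bigcupP[C CS xC]; have /sS := CS.
  rewrite inE => /minsetP[/andP[_ dC] mC].
  have sCX : C \subset X by rewrite eX; apply: bigcup_sup.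
  have iC : C :\ x \in indep M.
    apply/negPn/negP => nC; have := mC (C :\ x).
    rewrite nC (subset_trans (subD1set _ _) (subset_trans sCX sX)).
    by move=> /(_ isT (subD1set _ _)) e; move: xC; rewrite -e !inE eqxx.
  have [J [iJ sCJ sJX cJ]] := indep_extend iC (subset_trans (subD1set _ _) sCX).
  apply/eqP; rewrite eqn_leq rankS ?subD1set //= -cJ; apply: rank_ge => //.
  rewrite subsetD1 sJX; apply/negP => xJ; case/negP: dC; apply: indepS iJ.
  by rewrite -(setD1K xC) subUset sub1set xJ.
exists [set C in circuits M | C \subset X].
apply/andP; split; first by apply/subsetP => C; rewrite inE => /andP[].
rewrite eqEsubset; apply/andP; split; last first.
  by apply/bigcupsP => C; rewrite inE => /andP[].
apply/subsetP => x xX.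
have [I [iI _ sI cI]] := indep_extend (indep0 M) (sub0set (X :\ x)).
have xI : x \notin I by apply/negP => /(subsetP sI); rewrite !inE eqxx.
have sxI : x |: I \subset X.
  by rewrite subUset sub1set xX (subset_trans sI (subD1set _ _)).
have dI : x |: I \notin indep M.
  by apply/negP => /rank_ge-/(_ X sxI); rewrite -(h x xX) -cI cardsU1 xI; lia.
pose Q Y := (Y \subset ground M) && (Y \notin indep M).
have sdI : Q (x |: I).
  by rewrite /Q dI (subset_trans sxI sX).
have [C mC sC] := minset_exists sdI.
apply/bigcupP; exists C; first by rewrite inE (subset_trans sC sxI) andbT inE.
case/minsetP: mC => /andP[_ dC] _; apply/negPn/negP => xC; case/negP: dC.
apply: indepS iI; apply/subsetP => z zC; have := subsetP sC z zC.
by rewrite !inE => /orP[/eqP e|//]; rewrite -e zC in xC.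
Qed.

Lemma cyclic_flatsP M X :
  reflect [/\ X \subset ground M,
              forall y, y \in ground M -> y \notin X ->
                rank M X < rank M (y |: X)
            & forall x, x \in X -> rank M (X :\ x) = rank M X]
    (X \in cyclic_flats M).
Proof.
rewrite inE; apply: (iffP andP) => [[/andP[sX /forall_inP fX] cX] | [sX fX cX]].
  split=> // [y yE yX | ]; first by apply: fX; rewrite inE yX.
  by apply/(cyclicP sX).
split; last by apply/(cyclicP sX).
rewrite /flat sX; apply/forall_inP => y /setDP[yE yX]; exact: fX.
Qed.

Lemma rank_drop M X Y : X \subset Y -> [disjoint Y :\: X & ground M] ->
  rank M X = rank M Y.
Proof.
move=> sXY dis; rewrite -(rankI M X) -(rankI M Y); congr rank.
apply/eqP; rewrite eqEsubset setSI //=; apply/subsetP => z.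
rewrite !inE => /andP[zY zM]; rewrite zM andbT; apply: contraT => zX.
have /setP/(_ z) := disjoint_setI0 dis.
by rewrite !inE zX zY zM.
Qed.

Lemma rankU1_out M X y : y \notin ground M -> rank M (y |: X) = rank M X.
Proof.
move=> yM; apply/esym/rank_drop; first exact: subsetUr.
rewrite disjoints_subset; apply/subsetP => z; rewrite !inE.
by case: eqP => [-> | _]; rewrite ?yM //=; case: (z \in X).
Qed.

Lemma rankD1_out M X y : y \notin ground M -> rank M (X :\ y) = rank M X.
Proof.
move=> yM; apply/rank_drop; first exact: subD1set.
rewrite disjoints_subset; apply/subsetP => z; rewrite !inE.
by case: eqP => [-> | _]; rewrite ?yM //=; case: (z \in X).
Qed.

Lemma rankD1_step M X x : rank M X <= (rank M (X :\ x)).+1.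
Proof.
have := rank_diff M X (X :\ x); have : #|X :\: (X :\ x)| <= 1; last by lia.
rewrite -(cards1 x); apply: subset_leq_card; apply/subsetP => z; rewrite !inE.
by case: (z == x); case: (z \in X).
Qed.

Lemma loopE M e : loop M e = (e \in ground M) && (rank M [set e] == 0).
Proof.
rewrite /loop inE.
have r1 : ([set e] \notin indep M) = (rank M [set e] == 0).
  by rewrite indepE cards1; have := rank_card M [set e]; rewrite cards1; lia.
apply/minsetP/andP => [[] | [eM e0]]; first by rewrite sub1set r1 => /andP.
rewrite sub1set eM r1; split=> // B /andP[_ dB]; rewrite subset1.
by case/orP => /eqP // B0; rewrite B0 indep0 in dB.
Qed.

Lemma isthmusE M e : isthmus M e =
  (e \in ground M) && (rank M (ground M :\ e) < rank M (ground M)).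
Proof.
rewrite /isthmus; congr andb; apply/forall_inP/idP => [h | lt B].
  rewrite ltnNge; apply/negP => le.
  have [J [iJ _ sJ cJ]] := indep_extend (indep0 M) (sub0set (ground M :\ e)).
  have /h eJ : J \in bases M.
    by rewrite basesE iJ cJ eqn_leq le rankS ?subD1set.
  by have := subsetP sJ e eJ; rewrite !inE eqxx.
rewrite basesE => /andP[iB /eqP cB]; apply: contraT => eB.
have := rank_ge (X := ground M :\ e) iB.
by rewrite subsetD1 eB (indep_sub iB) => /(_ isT); lia.
Qed.

Section FreeProduct.

Variables M N : matroid.
Hypothesis disMN : [disjoint ground M & ground N].

(* The rank function of the free product whose independent sets A are those
   with A :&: ground M independent in M and nullity of A in N at most the
   corank of A in M. *)
Definition free_rank X : nat :=
  minn (rank M (ground M) + rank N X) (rank M X + #|X :&: ground N|).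

Lemma notinN x : x \in ground M -> x \notin ground N.
Proof. by move=> xM; rewrite (disjointFr disMN xM). Qed.

Lemma notinM x : x \in ground N -> x \notin ground M.
Proof. by move=> xN; rewrite (disjointFl disMN xN). Qed.

Lemma free_rank_card X : free_rank X <= #|X|.
Proof.
rewrite /free_rank; suff : rank M X + #|X :&: ground N| <= #|X| by lia.
have := rank_card M (X :&: ground M); rewrite rankI.
have := cardsUI (X :&: ground M) (X :&: ground N).
rewrite setIACA (disjoint_setI0 disMN) setI0 cards0 -setIUr.
have := subset_leq_card (subsetIl X (ground M :|: ground N)); lia.
Qed.

Lemma free_rankS X Y : X \subset Y -> free_rank X <= free_rank Y.
Proof.
move=> s; rewrite /free_rank; have := rankS M s; have := rankS N s.
have := subset_leq_card (setSI (ground N) s); lia.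
Qed.

Lemma free_rank_submod X Y :
  free_rank (X :|: Y) + free_rank (X :&: Y) <= free_rank X + free_rank Y.
Proof.
have mixed Z W : rank N (Z :|: W) + #|Z :&: W :&: ground N| <=
    rank N Z + #|W :&: ground N|.
  have := rank_diff N ((Z :|: W) :&: ground N) Z; rewrite rankI.
  have -> : ((Z :|: W) :&: ground N) :\: Z = (W :&: ground N) :\: Z.
    by apply/setP => z; rewrite !inE; case: (z \in Z).
  have := cardsID Z (W :&: ground N).
  suff -> : Z :&: W :&: ground N = W :&: ground N :&: Z by lia.
  by rewrite (setIC Z) setIAC.
have := rank_submod M X Y; have := rank_submod N X Y.
have := mixed X Y; have := mixed Y X; rewrite (setUC Y X) (setIC Y X).
have := rankS M (subsetIl X Y); have := rankS M (subsetIr X Y).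
have := cardsUI (X :&: ground N) (Y :&: ground N).
rewrite -setIUl -setIIl.
rewrite /free_rank; lia.
Qed.

Definition free_product : matroid :=
  rank_matroid (ground M :|: ground N) free_rank_card free_rankS
    free_rank_submod.

Lemma free_productE X : X \subset ground M :|: ground N ->
  rank free_product X = free_rank X.
Proof. exact: rank_matroidE. Qed.

Lemma rankM_N X Y : Y \subset ground N -> rank M (X :|: Y) = rank M X.
Proof.
move=> sY; apply/esym/rank_drop; first exact: subsetUl.
rewrite disjoints_subset; apply/subsetP => z; rewrite !inE.
by case: (z \in X) => //= /(subsetP sY)/notinM.
Qed.

Lemma rankN_M X Y : X \subset ground M -> rank N (X :|: Y) = rank N Y.
Proof.
move=> sX; apply/esym/rank_drop; first exact: subsetUr.
rewrite disjoints_subset; apply/subsetP => z; rewrite !inE.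
by case: (z \in Y) => //=; rewrite orbF => /(subsetP sX)/notinN.
Qed.

Lemma free_rankU X Y : X \subset ground M -> Y \subset ground N ->
  free_rank (X :|: Y) = minn (rank M (ground M) + rank N Y) (rank M X + #|Y|).
Proof.
move=> sX sY; rewrite /free_rank rankM_N // rankN_M //.
congr (minn _ (_ + _)); apply: eq_card => z; rewrite !inE.
have [zX|_] /= := boolP (z \in X).
  have zN := notinN (subsetP sX z zX); rewrite (negbTE zN).
  by apply/esym/negP => /(subsetP sY); apply/negP.
by have [/(subsetP sY) ->|] := boolP (z \in Y).
Qed.

Lemma free_rank_l X : X \subset ground M -> free_rank X = rank M X.
Proof.
move=> sX; rewrite -[X]setU0 free_rankU ?sub0set // setU0 cards0.
by have := rankS M sX; lia.
Qed.

Lemma free_rank_r Y : Y \subset ground N ->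
  free_rank (ground M :|: Y) = rank M (ground M) + rank N Y.
Proof. by move=> sY; rewrite free_rankU //; have := rank_card N Y; lia. Qed.

Lemma mem_Zfree X : X \in Zfree M N <->
  [\/ X \in cyclic_flats M /\ X != ground M,
      exists Y, [/\ Y \in cyclic_flats N, Y != set0 & X = ground M :|: Y]
    | [/\ forall e, ~~ isthmus M e, forall e, ~~ loop N e & X = ground M]].
Proof.
have Z' : X \in Zprime M N <->
  (X \in cyclic_flats M /\ X != ground M) \/
  exists Y, [/\ Y \in cyclic_flats N, Y != set0 & X = ground M :|: Y].
  rewrite inE; split.
    case/orP => [|/imsetP[Y]]; first by rewrite inE => /andP; left.
    by rewrite inE => /andP[cY Y0] eX; right; exists Y.
  case=> [[cX nX]|[Y [cY Y0 ->]]]; first by rewrite inE cX nX.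
  by apply/orP; right; apply/imsetP; exists Y => //; rewrite inE cY Y0.
rewrite /Zfree; case: ifP => [/andP[/forallP i /forallP l] | h].
  rewrite in_setU1; split.
    case/orP => [/eqP|/Z'[]]; [by constructor 3 | by constructor 1
      | by constructor 2].
  case=> [c|c|[_ _ ->]]; last by rewrite eqxx.
  - by apply/orP; right; apply/Z'; left.
  - by apply/orP; right; apply/Z'; right.
split; first by case/Z'; [constructor 1 | constructor 2].
case=> [c|c|[i l _]]; first by apply/Z'; left.
  by apply/Z'; right.
by move: h; rewrite (introT forallP i) (introT forallP l).
Qed.

Lemma cyclic_flats_free_productP X :
  reflect [/\ X \subset ground M :|: ground N,
              forall y, y \in ground M :|: ground N -> y \notin X ->
                free_rank X < free_rank (y |: X)
            & forall x, x \in X -> free_rank (X :\ x) = free_rank X]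
    (X \in cyclic_flats free_product).
Proof.
apply: (iffP (cyclic_flatsP _ _)) => -[/= sX fX cX]; split=> //.
- move=> y yE yX; have := fX y yE yX.
  by rewrite !free_productE // subUset sX sub1set yE.
- move=> x xX; have := cX x xX.
  by rewrite !free_productE // (subset_trans (subD1set _ _) sX).
- move=> y yE yX; have := fX y yE yX.
  by rewrite !free_productE // subUset sX sub1set yE.
- move=> x xX; have := cX x xX.
  by rewrite !free_productE // (subset_trans (subD1set _ _) sX).
Qed.

Lemma setU1_notin (y : T) X Y : y |: (X :|: Y) = X :|: (y |: Y).
Proof. by rewrite setUCA. Qed.

Lemma cyclic_flats_free_product : cyclic_flats free_product = Zfree M N.
Proof.
have D1l x X : x \in ground N -> (ground M :|: X) :\ x = ground M :|: X :\ x.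
  move=> xN; apply/setP => z; rewrite !inE.
  by case: eqP => [->|//]; rewrite (negbTE (notinM xN)).
apply/setP => X; apply/idP/idP.
  case/cyclic_flats_free_productP => sX fX cX; apply/mem_Zfree.
  have eX : X = (X :&: ground M) :|: (X :&: ground N).
    by rewrite -setIUr (setIidPl sX).
  have [sMX|] := boolP (ground M \subset X); last first.
    case/subsetPn => e eM eX'; constructor 1.
    have lt := fX e _ eX'; rewrite inE eM in lt; move: lt => /(_ isT).
    have := rankU1_out X (notinN eM).
    have NX : (e |: X) :&: ground N = X :&: ground N.
      apply/setP => z; rewrite !inE; case: eqP => [->|//].
      by rewrite (negbTE (notinN eM)) !andbF.
    rewrite {1 2}/free_rank NX => -> lt.
    have X0 : X :&: ground N = set0.
      apply/eqP; apply: contraT => /set0Pn[y]; rewrite inE => /andP[yX yN].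
      have := cX y yX; rewrite /free_rank (rankD1_out X (notinM yN)).
      have := cardsD1 y (X :&: ground N); rewrite inE yX yN.
      have -> : (X :&: ground N) :\ y = (X :\ y) :&: ground N.
        by rewrite -setIDAC.
      by have := rankS N (subD1set X y); have := rankD1_step N X y; lia.
    have sXM : X \subset ground M by rewrite eX X0 setU0 subsetIr.
    split; last by apply: contraNneq eX' => ->.
    apply/cyclic_flatsP; split=> // [y yM yX | x xX].
      have := fX y _ yX; rewrite inE yM => /(_ isT).
      by rewrite !free_rank_l // subUset sub1set yM.
    have := cX x xX.
    by rewrite !free_rank_l // (subset_trans (subD1set _ _)).
  move: eX; rewrite (setIidPr sMX); set Y := X :&: ground N => eX.
  have sY : Y \subset ground N by apply: subsetIr.
  move: Y eX sY => Y eX sY.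
  have fY y : y \in ground N -> y \notin Y -> rank N Y < rank N (y |: Y).
    move=> yN yY; have := fX y; rewrite eX !inE yN (negbTE yY) orbT orbF notinM //.
    move=> /(_ isT isT); rewrite setU1_notin !free_rank_r //; first lia.
    by rewrite subUset sub1set yN.
  have [Y0|Y0] := eqVneq Y set0.
    rewrite Y0 setU0 in eX; constructor 3; split=> // e.
      rewrite isthmusE; apply/negP => /andP[eM]; have := cX e.
      by rewrite eX !free_rank_l ?subD1set // => /(_ eM) ->; rewrite ltnn.
    rewrite loopE; apply/negP => /andP[eN /eqP r0]; have := fY e eN.
    by rewrite Y0 inE setU0 r0 => /(_ isT).
  constructor 2; exists Y; split=> //; apply/cyclic_flatsP; split=> // x xY.
  have xN := subsetP sY x xY.
  have := cX x; rewrite eX inE xY orbT D1l // => /(_ isT).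
  by rewrite !free_rank_r ?(subset_trans (subD1set _ _)) //; lia.
move=> /mem_Zfree h; apply/cyclic_flats_free_productP; case: h.
- case=> /cyclic_flatsP[sX fX cX] nX; split.
  + exact: subset_trans sX (subsetUl _ _).
  + have ltX : rank M X < rank M (ground M).
      have /subsetPn[e eM eX] : ~~ (ground M \subset X).
        by apply: contra nX => s; rewrite eqEsubset sX.
      apply: leq_trans (fX e eM eX) _.
      by apply: rankS; rewrite subUset sub1set eM.
    move=> y; rewrite inE => /orP[yM|yN] yX.
      by rewrite !free_rank_l ?fX // subUset sub1set yM.
    rewrite setUC free_rankU ?sub1set // free_rank_l // cards1; lia.
  + by move=> x xX; rewrite !free_rank_l ?cX // (subset_trans (subD1set _ _)).
- case=> Y [/cyclic_flatsP[sY fY cY] Y0 ->]; split.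
  + exact: setUS.
  + move=> y yE; rewrite inE negb_or => /andP[yM yY].
    move: yE; rewrite inE (negbTE yM) => /= yN; rewrite setU1_notin.
    rewrite !free_rank_r //; first by have := fY y yN yY; lia.
    by rewrite subUset sub1set yN.
  + move=> x; rewrite inE => /orP[xM | xY]; last first.
      rewrite D1l ?(subsetP sY) // !free_rank_r ?cY //.
      exact: subset_trans (subD1set _ _) sY.
    have -> : (ground M :|: Y) :\ x = ground M :\ x :|: Y.
      apply/setP => z; rewrite !inE; case: eqP => [->|//] /=.
      by apply/esym/negP => /(subsetP sY)/notinM; rewrite xM.
    rewrite free_rankU ?subD1set // free_rank_r //.
    have := rankD1_step M (ground M) x.
    case/set0Pn: Y0 => y yY; have := cY y yY; have := rank_card N (Y :\ y).
    by have := cardsD1 y Y; rewrite yY; lia.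
case=> i l ->; split; first exact: subsetUl.
  move=> y; rewrite inE => /orP[-> //|yN] yM.
  rewrite setUC free_rank_r ?sub1set // free_rank_l //.
  by have := l y; rewrite loopE yN; lia.
move=> x xM; rewrite !free_rank_l ?subD1set //.
have := i x; rewrite isthmusE xM -leqNgt /= => le.
by apply/eqP; rewrite eqn_leq le rankS ?subD1set.
Qed.

(* The Crapo-Schmitt construction realizes the defining data, so
   is_free_product is satisfied by some matroid whenever the two ground sets
   are disjoint. *)
Lemma free_productP : is_free_product M N free_product.
Proof.
split=> //; first exact: cyclic_flats_free_product.
  move=> X _ sX; rewrite free_productE ?free_rank_l //.
  exact: subset_trans sX (subsetUl _ _).
by move=> Y sY _; rewrite free_productE ?free_rank_r // setUS.
Qed.

End FreeProduct.

End Matroids.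

Arguments matroid T : clear implicits.

(* Main.v *)
Require Import Defs.
From mathcomp Require Import all_boot.
From mathcomp Require Import zify.

(** Each closure property comes from maps between cyclic-flat lattices under
    which comparable images have comparable preimages, since such maps carry
    antichains injectively to antichains. For duals the map is complementation
    in the ground set, and for a deletion it is the closure operator of the
    bigger matroid (a cyclic flat F of the deletion of D is recovered from its
    closure by removing D). Contraction is deletion conjugated by duality. In a
    free product each proper cyclic flat of the first factor lies below every
    set containing the first ground set, so an antichain lives in one factor or
    is the single set [ground M]; the last case needs k > 0. *)

Section CyclicWidth.

Set Implicit Arguments.
Unset Strict Implicit.

Context {T : finType}.
Implicit Types (X Y D : {set T}) (A F G : {set {set T}}) (M N P : matroid T).

Lemma antichain_comparable A X Y : antichain A -> X \in A -> Y \in A ->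
  (X \subset Y) || (Y \subset X) -> X = Y.
Proof.
move=> /forall_inP acA XA YA; case/orP => s; last apply/esym; apply/eqP.
  by have /implyP := forall_inP (acA X XA) Y YA; apply.
by have /implyP := forall_inP (acA Y YA) X XA; apply.
Qed.

Lemma width_leP F k :
  reflect (forall A, A \subset F -> antichain A -> #|A| <= k) (width F <= k).
Proof.
apply: (iffP (bigmax_leqP _ _ _)) => h A.
  by move=> sA acA; apply: h; rewrite powersetE sA.
by rewrite powersetE => /andP[]; apply: h.
Qed.

(** Equal images are comparable, so [f] is injective on [A] and its image is again an antichain. The
    hypotheses are asked on [A] alone because removing [ground M], the map used for free products,
    meets them only on suitable antichains. *)
Lemma antichain_map_card (f : {set T} -> {set T}) A G :
    antichain A -> {in A, forall X, f X \in G} ->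
    {in A &, forall X Y, f X \subset f Y -> (X \subset Y) || (Y \subset X)} ->
  #|A| <= width G.
Proof.
move=> acA fG fc.
have f_inj : {in A &, injective f}.
  move=> X Y XA YA e; apply: (antichain_comparable acA) => //.
  by apply: fc; rewrite ?e.
rewrite -(card_in_imset f_inj); apply: (elimT (width_leP G _) (leqnn _)).
  by apply/subsetP => _ /imsetP[X XA ->]; apply: fG.
apply/forall_inP => _ /imsetP[X XA ->]; apply/forall_inP => _ /imsetP[Y YA ->].
apply/implyP => s; apply/eqP; congr f.
by apply: (antichain_comparable acA) => //; apply: fc.
Qed.

Lemma width_map (f : {set T} -> {set T}) F G :
    {in F, forall X, f X \in G} ->
    {in F &, forall X Y, f X \subset f Y -> (X \subset Y) || (Y \subset X)} ->
  width F <= width G.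
Proof.
move=> fG fc; apply/width_leP => A /subsetP sA acA.
apply: (antichain_map_card (f := f)) => // [X /sA | X Y /sA XF /sA YF]; first exact: fG.
exact: fc.
Qed.

(** Rank depends only on the independent sets, and those of [dual M] are the ones cut out by the
    function [dual_rank]. *)
Lemma rank_dual M X : X \subset ground M -> rank (dual M) X = dual_rank M X.
Proof.
rewrite {1}/rank /= dual_indepE.
move=> sX; apply: (rank_matroidE (dual_rank_card M) (@dual_rankS _ M) (dual_rank_submod M) sX).
Qed.

Lemma rank_delete M D X : X \subset ground M :\: D ->
  rank (delete M D) X = rank M X.
Proof.
move=> sX; apply: eq_bigl => I /=; rewrite inE -andbA; congr andb.
by apply: andb_idl => sI; apply: subset_trans sX.
Qed.

(** Complementation exchanges the two conditions: cyclicity of [X] in the dual gives flatness of the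
    complement, and flatness of [X] gives its cyclicity. *)
Lemma cyclic_flats_dual M X : X \in cyclic_flats (dual M) ->
  ground M :\: X \in cyclic_flats M.
Proof.
case/cyclic_flatsP => /= sX fX cX.
have rC Y : rank M (~: Y) = rank M (ground M :\: Y).
  by rewrite -rankI setIC -setDE.
apply/cyclic_flatsP; split; first exact: subsetDl.
- move=> x xM; rewrite inE xM andbT negbK => xX.
  have := cX x xX; rewrite !rank_dual ?(subset_trans (subD1set _ _)) //.
  (* These bounds make the truncated subtraction in [dual_rank] exact. *)
  have := dual_rank_sub M X; have := dual_rank_sub M (X :\ x).
  rewrite /dual_rank !rC (cardsD1 x X) xX.
  have -> : ground M :\: (X :\ x) = x |: (ground M :\: X).
    by apply/setP => z; rewrite !inE; case: eqP => // ->; rewrite xM.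
  lia.
move=> y /setDP[yM yX]; have := fX y yM yX.
have sU : y |: X \subset ground M by rewrite subUset sub1set yM.
rewrite !rank_dual //.
have := dual_rank_sub M X; have := dual_rank_sub M (y |: X).
rewrite /dual_rank !rC cardsU1 yX.
have -> : ground M :\: (y |: X) = (ground M :\: X) :\ y.
  by apply/setP => z; rewrite !inE negb_or andbA.
have := rankS M (subD1set (ground M :\: X) y); lia.
Qed.

Lemma cyclic_width_dual M : cyclic_width (dual M) <= cyclic_width M.
Proof.
apply: (width_map (f := fun X => ground M :\: X)) => [X | X Y].
  exact: cyclic_flats_dual.
move=> /cyclic_flatsP[/= sX _ _] /cyclic_flatsP[/= sY _ _] s.
apply/orP; right; apply/subsetP => z zY; apply: contraT => zX.
have := subsetP s z; rewrite !inE zX zY (subsetP sY _ zY) => /(_ isT).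
by [].
Qed.

(** Points of [T] outside [ground M] never raise the rank, so they have to be excluded
    explicitly. *)
Definition closure M X : {set T} :=
  [set y in ground M | rank M (y |: X) == rank M X].

Lemma sub_closure M X : X \subset ground M -> X \subset closure M X.
Proof.
move=> sX; apply/subsetP => x xX.
by rewrite inE (subsetP sX) //= (setUidPr _) ?sub1set.
Qed.

Lemma rank_closure M X : X \subset ground M -> rank M (closure M X) = rank M X.
Proof.
move=> sX; rewrite -{1}(setUidPr (sub_closure sX)).
apply: (r_closure (@rankS _ M) (rank_submod M)) => y.
by rewrite inE => /andP[_ /eqP].
Qed.

(** Once [x] is removed, the closure still contains [X], or [X :\ x] if [x] lies in [X]; either has
    the rank of the whole closure. *)
Lemma closure_cyclic_flat M X : X \subset ground M ->
    {in X, forall x, rank M (X :\ x) = rank M X} ->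
  closure M X \in cyclic_flats M.
Proof.
move=> sX cX; have sC := sub_closure sX.
apply/cyclic_flatsP; split.
- by apply/subsetP => y; rewrite inE => /andP[].
- move=> y yM; rewrite inE yM rank_closure //= => ne.
  have := rankS M (setUS [set y] sC); have := rankS M (subsetUr [set y] X).
  by move/eqP: ne; lia.
move=> x _; apply/eqP; rewrite eqn_leq rankS ?subD1set //= rank_closure //.
have [xX | xX] := boolP (x \in X); first by rewrite -(cX x xX) rankS ?setSD.
by rewrite rankS // subsetD1 sC xX.
Qed.

Lemma cyclic_width_delete M D : cyclic_width (delete M D) <= cyclic_width M.
Proof.
have closureD X : X \in cyclic_flats (delete M D) -> closure M X :\: D = X.
  case/cyclic_flatsP => /= sX fX _; apply/eqP; rewrite eqEsubset; apply/andP; split.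
    (* A point of the closure outside both [D] and [X] would contradict flatness of [X] in the
       deletion. *)
    apply/subsetP => y; rewrite !inE => /and3P[yD yM /eqP r_y].
    apply: contraT => yX; have := fX y; rewrite inE yD yM => /(_ isT yX).
    by rewrite !rank_delete ?r_y ?ltnn // subUset sub1set inE yD yM.
  have := sX; rewrite subsetD => /andP[sXM dX].
  by rewrite subsetD sub_closure.
apply: (width_map (f := closure M)) => [X /cyclic_flatsP[/= sX _ cX] | X Y XZ YZ s].
  apply: closure_cyclic_flat => [|x xX]; first exact: subset_trans sX (subsetDl _ _).
  have := cX x xX; rewrite !rank_delete //.
  exact: subset_trans (subD1set _ _) sX.
by rewrite -(closureD X XZ) -(closureD Y YZ) setSD.
Qed.

Lemma cyclic_width_minor M N : minor N M -> cyclic_width N <= cyclic_width M.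
Proof.
(* The outer deletion is peeled off first, then the dual, deletion and dual that make up the
   contraction. *)
case=> C [D [_ _ _ ->]]; apply: leq_trans (cyclic_width_delete _ _) _.
apply: leq_trans (cyclic_width_dual _) _.
exact: leq_trans (cyclic_width_delete _ _) (cyclic_width_dual _).
Qed.

Lemma cyclic_width_free_product k M N P : 0 < k -> is_free_product M N P ->
  cyclic_width M <= k -> cyclic_width N <= k -> cyclic_width P <= k.
Proof.
move=> k_gt0 [dMN _ cP _ _] wM wN; apply/width_leP => A /subsetP sA acA.
have AP X : X \in A -> X \in Zfree M N by rewrite -cP; apply: sA.
(* [ground M] is comparable with every cyclic flat of [P], so an antichain containing it is a
   singleton. *)
have [EA | EA] := boolP (ground M \in A).
  apply: leq_trans k_gt0; rewrite -(cards1 (ground M)); apply: subset_leq_card.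
  apply/subsetP => X XA; rewrite inE; apply/eqP.
  apply: (antichain_comparable acA) => //.
  case: (iffLR (mem_Zfree M N X) (AP X XA)) => [[/cyclic_flatsP[-> _ _] _] //||].
    by move=> [Y [_ _ ->]]; rewrite subsetUl orbT.
  by move=> [_ _ ->]; rewrite subxx.
have split_A X : X \in A -> X \in cyclic_flats M \/
    [/\ ground M \subset X & X :\: ground M \in cyclic_flats N].
  move=> XA; case: (iffLR (mem_Zfree M N X) (AP X XA)) => [[XM _]||[_ _ eX]].
  - by left.
  - move=> [Y [YN _ ->]]; right; split; first exact: subsetUl.
    have [sY _ _] := elimT (cyclic_flatsP _ _) YN.
    rewrite setDUl setDv set0U; suff -> : Y :\: ground M = Y by [].
    apply/setDidPl; rewrite disjoint_sym.
    exact: disjointWr sY dMN.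
  by move: EA; rewrite -eX XA.
have [sAM | /subsetPn[X0 X0A nX0]] := boolP (A \subset cyclic_flats M).
  by apply: leq_trans wM; move/width_leP: (leqnn (cyclic_width M)); apply.
have [|[sX0 _]] := split_A X0 X0A; first by rewrite (negbTE nX0).
(* A member that is a cyclic flat of [M] would lie inside [ground M], hence inside [X0], and so
   equal [X0], which is not a cyclic flat of [M]. *)
have sAN X : X \in A -> ground M \subset X /\ X :\: ground M \in cyclic_flats N.
  move=> XA; have [XM | []//] := split_A X XA.
  have [sX _ _] := elimT (cyclic_flatsP _ _) XM.
  case/negP: nX0; rewrite -(antichain_comparable acA XA X0A) //.
  by rewrite (subset_trans sX sX0).
apply: leq_trans wN; apply: (antichain_map_card (f := fun X => X :\: ground M)) => //.
  by move=> X /sAN[].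
move=> X Y /sAN[sX _] /sAN[sY _] s.
(* Both sets contain [ground M], so inclusion of the differences gives back inclusion of the
   sets. *)
by rewrite -(setID X (ground M)) -(setID Y (ground M)) !(setIidPr _) // setUS.
Qed.

End CyclicWidth.

Theorem theorem5p1 (k : nat) (hk : 0 < k) :
  [/\ (forall (T : finType) (M : matroid T), CW k M -> CW k (dual M)),
      (forall (T : finType) (M N : matroid T),
         CW k M -> minor N M -> CW k N) &
      (forall (T : finType) (M N P : matroid T),
         CW k M -> CW k N -> is_free_product M N P -> CW k P)].
Proof.
rewrite /CW; split=> [T M | T M N wM mN | T M N P wM wN fP].
- exact: leq_trans (cyclic_width_dual M).
- exact: leq_trans (cyclic_width_minor mN) wM.
- exact: cyclic_width_free_product hk fP wM wN.
Qed.
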